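(* Let $G:\mathbb{Z}_{\ge 0}\to\mathbb{Z}_{\ge 0}$ be the function defined by: $G(n)$ is the largest integer $k$ with $0\le k\le n$ such that multiset-reconstructibility holds for $(n,k)$. Then \[ \lim_{n\to\infty}\frac{G(n)}{n}=1, \] and moreover $n-G(n)=O(n/\log n)$ as $n\to\infty$.
   Context: A partition $\lambda=[\lambda_1,\lambda_2,\dots]$ of $n\in\mathbb{Z}_{\ge0}$ is a weakly decreasing sequence of non-negative integers with sum $n$. For partitions $\mu,\lambda$ write $\mu\le\lambda$ if $\mu_i\le\lambda_i$ for all $i$. For $n\ge k\ge 0$ and $\lambda\vdash n$, a $k$-minor of $\lambda$ is a partition $\mu\vdash n-k$ with $\mu\le\lambda$. $N(\lambda/\mu)$ denotes the number of standard Young tableaux of skew shape $\lambda/\mu$ (with $N(\lambda/\mu)=0$ if $\mu\not\le\lambda$). $\widehat{M}_k(\lambda)$ is the multiset of $k$-minors $\mu$ of $\lambda$, each $\mu$ having multiplicity $N(\lambda/\mu)$; thus $\widehat{M}_k(\lambda)=\widehat{M}_k(\nu)$ means $N(\lambda/\tau)=N(\nu/\tau)$ for all $\tau\vdash n-k$. Multiset-reconstructibility holds for $(n,k)$ (with $n\ge k\ge0$) if for all partitions $\mu,\nu$ of $n$, $\widehat{M}_k(\mu)=\widehat{M}_k(\nu)$ implies $\mu=\nu$. (It holds trivially for $k=0$.) $\log$ is the natural logarithm. *)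

(* Defs.v *)
From mathcomp Require Import all_boot all_order all_algebra.
From mathcomp Require Import all_classical all_reals all_analysis.

Set Implicit Arguments.
Unset Strict Implicit.
Unset Printing Implicit Defensive.

(* A partition is the finite sequence of its nonzero parts: la_(i+1) is
   nth 0 la i, which is 0 for i >= size la.  Excluding zero parts makes equality
   of partitions coincide with equality of sequences. *)
Definition partition_of (n : nat) (la : seq nat) : bool :=
  [&& sorted geq la, 0 \notin la & sumn la == n].

Definition part_le (mu la : seq nat) : bool :=
  [forall i : 'I_(maxn (size mu) (size la)), nth 0 mu i <= nth 0 la i].

Lemma part_leP (mu la : seq nat) :
  reflect (forall i, nth 0 mu i <= nth 0 la i) (part_le mu la).
Proof.
apply: (iffP forallP) => [H i|H i]; last exact: H.
have [lti|lei] := ltnP i (maxn (size mu) (size la)); first exact: H (Ordinal lti).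
by rewrite nth_default // (leq_trans (leq_maxl _ _) lei).
Qed.

(* Cells (i, j), row and column numbered from 0, of the skew diagram la / mu;
   head 0 la is the number of columns of la. *)
Definition skew_cells (la mu : seq nat) :
    {set 'I_(size la) * 'I_(head 0 la)} :=
  [set c : 'I_(size la) * 'I_(head 0 la) |
     nth 0 mu c.1 <= c.2 < nth 0 la c.1].

Definition skew_cell (la mu : seq nat) : finType :=
  {c : 'I_(size la) * 'I_(head 0 la) | c \in skew_cells la mu}.

(* Fillings use the entries 0, ..., m - 1 instead of 1, ..., m, where m is the
   number of cells; an injective one uses each entry exactly once. *)
Definition is_syt (la mu : seq nat)
    (t : {ffun skew_cell la mu -> 'I_#|skew_cells la mu|}) : bool :=
  [&& injectiveb t,
      [forall c : skew_cell la mu, forall d : skew_cell la mu,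
         ((val c).1 == (val d).1) && ((val c).2 < (val d).2) ==> (t c < t d)]
    & [forall c : skew_cell la mu, forall d : skew_cell la mu,
         ((val c).2 == (val d).2) && ((val c).1 < (val d).1) ==> (t c < t d)]].

Definition num_syt (la mu : seq nat) : nat :=
  if part_le mu la then #|[set t | @is_syt la mu t]| else 0.

Definition is_minor (k : nat) (la mu : seq nat) : bool :=
  partition_of (sumn la - k) mu && part_le mu la.

(* A multiset of partitions is given by its multiplicity function. *)
Definition minors_mset (k : nat) (la : seq nat) : seq nat -> nat :=
  fun mu => if is_minor k la mu then num_syt la mu else 0.

Definition mset_reconstructible (n k : nat) : Prop :=
  forall mu nu : seq nat, partition_of n mu -> partition_of n nu ->
    minors_mset k mu =1 minors_mset k nu -> mu = nu.

Definition G (n : nat) : nat :=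
  \max_(k < n.+1 | `[< mset_reconstructible n k >]) k.

Lemma partition_of_inj (n : nat) (mu nu : seq nat) :
  partition_of n mu -> partition_of n nu -> part_le mu nu -> mu = nu.
Proof.
case/and3P=> _ mu0 /eqP smu /and3P[_ nu0 /eqP snu] /part_leP.
move: smu; rewrite -snu => {snu n}.
elim: mu nu mu0 nu0 => [|x mu IH] [|y nu] //=.
- by move=> _; rewrite inE negb_or; case: y.
- by move=> + _ _ /(_ 0); rewrite inE; case: x.
rewrite !inE !negb_or => /andP[_ mu0] /andP[_ nu0] e le.
have lexy := le 0.
have le' i : nth 0 mu i <= nth 0 nu i := le i.+1.
have les (s t : seq nat) : 0 \notin s -> (forall i, nth 0 s i <= nth 0 t i) ->
    sumn s <= sumn t.
  elim: s t => [//|a s IHs] [|b t] /=.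
    by move=> + /(_ 0) /=; case: a.
  rewrite inE negb_or => /andP[_ s0] H.
  by apply: leq_add; [exact: (H 0) | apply: IHs => // i; exact: (H i.+1)].
have ls := les _ _ mu0 le'.
have exy : x = y.
  apply/eqP; rewrite eqn_leq lexy /=.
  by rewrite -(leq_add2r (sumn mu)) e leq_add2l.
by move: e; rewrite exy => /addnI e; rewrite (IH nu).
Qed.

Lemma mset_reconstructible0 (n : nat) : mset_reconstructible n 0.
Proof.
move=> mu nu pmu pnu /(_ mu); rewrite /minors_mset /is_minor !subn0.
have [/and3P[_ _ /eqP smu] /and3P[_ _ /eqP snu]] := (pmu, pnu).
have lemm : part_le mu mu by apply/part_leP.
rewrite smu snu pmu lemm /=.
case: ifP => [le _|_]; first exact: (partition_of_inj pmu pnu le).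
rewrite /num_syt lemm => /eqP; rewrite cards_eq0 => /eqP/setP H.
have cells0 (c : skew_cell mu mu) : False.
  by case: c => c; rewrite inE => /andP[a b]; have := leq_ltn_trans a b; rewrite ltnn.
pose t : {ffun skew_cell mu mu -> 'I_#|skew_cells mu mu|} :=
  [ffun c => False_rect _ (cells0 c)].
have := H t; rewrite !inE => /negP[].
apply/and3P; split; first by apply/injectiveP => c; case: (cells0 c).
- by apply/forallP => c; case: (cells0 c).
- by apply/forallP => c; case: (cells0 c).
Qed.

Lemma GP (n : nat) :
  [/\ G n <= n, mset_reconstructible n (G n) &
      forall k, k <= n -> mset_reconstructible n k -> k <= G n].
Proof.
have P0 : `[< mset_reconstructible n (@ord0 n) >].
  by apply/asboolP; exact: mset_reconstructible0.
have [k /asboolP Pk Gk] : {k : 'I_n.+1 | `[< mset_reconstructible n k >] & G n = k}.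
  by rewrite /G; apply: eq_bigmax_cond; apply/card_gt0P; exists ord0.
split; first by rewrite Gk -ltnS.
- by rewrite Gk.
move=> j lej Pj.
apply: (@leq_bigmax_cond _ _ (fun k : 'I_n.+1 => k : nat) (Ordinal (lej : j < n.+1))).
exact/asboolP.
Qed.

(* Main.v *)
(* Write l_i = la_i - i and, for functions f on Z^L, let
     (X^j_g f)(l) = sum_i g(l_i) f(l - j e_i),   B = X^1_1.
   On alternating functions B is the branching rule "remove a corner": removals
   that do not give a partition produce two equal coordinates.  Hence (B^r w)(la)
   = sum over tau |- |la| - r of w(tau) N(la/tau), and B^n F0 (la) = f^la, where
   F0 is the alternating delta function at the empty partition.  The commutator
   of X^j_g with B is X^(j+1)_(nabla g), where nabla g(x) = g(x) - g(x-1).  If g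
   is a polynomial of degree at most m, nabla^(m+1) g = 0, so
     (sum_i g(l_i)) B^n F0 = B^(n-m) w
   with w independent of la: the numbers N(la/tau), tau |- m, determine
   sum_i g(la_i - i) for all g of degree at most m.
   Take g = nabla P.  Then sum_i g(la_i - i) only involves the values of P at the
   ends of the runs of consecutive integers in {la_i - i}, of which there are
   O(sqrt n).  Choosing P to vanish at all but one of the run ends of two
   partitions shows that the run ends agree, so m of order sqrt n suffices and
   n - G(n) = O(sqrt n). *)
Require Import Defs.
From mathcomp Require Import all_boot all_order all_algebra all_fingroup.
From mathcomp Require Import all_classical all_reals all_analysis.
From mathcomp Require Import zify ring lra.
Import Order.TTheory GRing.Theory Num.Theory.
Import numFieldNormedType.Exports.

Set Implicit Arguments.
Unset Strict Implicit.
Unset Printing Implicit Defensive.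

(** * Linear extensions of a finite relation *)

Definition lin_ext (X : finType) (e : rel X) (n : nat) : {set {ffun X -> 'I_n}} :=
  [set t : {ffun X -> 'I_n} | injectiveb t && [forall c, forall d, e c d ==> (t c < t d)]].

Lemma lin_extP (X : finType) (e : rel X) n (t : {ffun X -> 'I_n}) :
  reflect (injective t /\ forall c d, e c d -> t c < t d) (t \in lin_ext e n).
Proof.
rewrite inE; apply: (iffP andP) => -[ti te]; split.
- exact/injectiveP.
- by move=> c d ecd; move/forallP/(_ c)/forallP/(_ d)/implyP: te; apply.
- exact/injectiveP.
- by apply/forallP=> c; apply/forallP=> d; apply/implyP/te.
Qed.

(** Nothing lies above [b], so a labelling of the other elements extends by giving [b] the largest
    label, and restriction inverts this. The map [h] presents [Y] as [X] without [b]. *)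
Lemma card_lin_ext_max (X Y : finType) (e : rel X) (e' : rel Y) n
    (h : Y -> X) (b : X) :
  injective h -> (forall y, h y != b) -> (forall x, x != b -> exists y, h y = x) ->
  (forall y z, e (h y) (h z) = e' y z) -> (forall x, e b x = false) ->
  #|[set t in lin_ext e n.+1 | t b == ord_max]| = #|lin_ext e' n|.
Proof.
move=> hI hb hsurj he bmax.
pose g (x : X) : option Y := [pick y | h y == x].
have gh y : g (h y) = Some y.
  rewrite /g; case: pickP => [z /eqP/hI-> //|/(_ y)]; by rewrite eqxx.
have gb : g b = None.
  by rewrite /g; case: pickP => // z; rewrite (negbTE (hb z)).
pose ext (s : {ffun Y -> 'I_n}) : {ffun X -> 'I_n.+1} :=
  [ffun x => if g x is Some y then widen_ord (leqnSn n) (s y) else ord_max].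
have exth s y : ext s (h y) = s y :> nat by rewrite ffunE gh.
have extb s : ext s b = ord_max by rewrite ffunE gb.
have extI : injective ext.
  move=> s1 s2 /ffunP es; apply/ffunP=> y; apply/val_inj.
  by have /(congr1 (@nat_of_ord _)) := es (h y); rewrite !exth.
have xP x : x = b \/ exists y, x = h y.
  by have [->|/hsurj[y <-]] := eqVneq x b; [left|right; exists y].
rewrite -(card_imset _ extI); congr #|pred_of_set _|.
apply/setP=> t; rewrite inE; apply/andP/imsetP => [[/lin_extP[tI te] /eqP tb]|].
  have tlt y : t (h y) < n.
    rewrite ltn_neqAle -ltnS ltn_ord andbT; apply/negP=> /eqP tn.
    have : t (h y) = t b by rewrite tb; apply/val_inj.
    by move/tI/eqP; rewrite (negbTE (hb y)).
  pose s := [ffun y => Ordinal (tlt y)].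
  exists s; last first.
    apply/ffunP=> x; apply/val_inj; have [->|[y ->]] := xP x.
      by rewrite tb extb.
    by rewrite [RHS]exth ffunE.
  apply/lin_extP; split=> [y z|y z].
    by rewrite !ffunE => /(congr1 val)/= /val_inj/tI/hI.
  by rewrite -he !ffunE /=; apply: te.
case=> s /lin_extP[sI se] ->; split; last by rewrite extb.
apply/lin_extP; split=> [x x'|x x'].
  have [->|[y ->]] := xP x; have [->|[y' ->]] := xP x' => //.
  - move/(congr1 (@nat_of_ord _)); rewrite extb exth /= => ey.
    by have := ltn_ord (s y'); rewrite -ey ltnn.
  - move/(congr1 (@nat_of_ord _)); rewrite extb exth /= => ey.
    by have := ltn_ord (s y); rewrite ey ltnn.
  - by move/(congr1 (@nat_of_ord _)); rewrite !exth => /val_inj/sI->.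
have [->|[y ->]] := xP x; first by rewrite bmax.
have [->|[y' ->]] := xP x'; first by rewrite exth extb.
by rewrite !exth he => /se.
Qed.

Definition cell_lt la mu : rel (skew_cell la mu) := fun c d =>
  (((val c).1 == (val d).1) && ((val c).2 < (val d).2)) ||
  (((val c).2 == (val d).2) && ((val c).1 < (val d).1)).

Lemma num_syt_lin_ext la mu : part_le mu la ->
  num_syt la mu = #|lin_ext (@cell_lt la mu) #|skew_cell la mu| |.
Proof.
move=> le; rewrite /num_syt le.
have -> : #|skew_cell la mu| = #|skew_cells la mu| by rewrite card_sig.
congr #|pred_of_set _|; apply/setP=> t; rewrite !inE /is_syt; congr (_ && _).
apply/andP/forallP => [[/forallP H1 /forallP H2] c|H].
  apply/forallP=> d; apply/implyP; rewrite /cell_lt => /orP[].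
    by move/forallP/(_ d)/implyP: (H1 c).
  by move/forallP/(_ d)/implyP: (H2 c).
by split; apply/forallP=> c; apply/forallP=> d; apply/implyP=> cd;
  move/forallP/(_ d)/implyP: (H c); apply; rewrite /cell_lt cd ?orbT.
Qed.

(** * Partitions as sequences and removal of a box *)

Lemma sumn_nth s N : size s <= N -> sumn s = \sum_(i < N) nth 0 s i.
Proof.
elim: s N => [|x s IH] N /=; first by rewrite big1 // => i _; rewrite nth_nil.
by case: N => // N sN; rewrite big_ord_recl /= (IH N).
Qed.

Lemma sorted_geqP s :
  reflect (forall i, nth 0 s i.+1 <= nth 0 s i) (sorted geq s).
Proof.
apply: (iffP (sortedP 0)) => H i; last by move=> _; apply: H.
by have [/H//|le] := ltnP i.+1 (size s); rewrite nth_default.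
Qed.

Lemma sorted_geq_nth s i j : sorted geq s -> i <= j -> nth 0 s j <= nth 0 s i.
Proof.
move=> /sorted_geqP H; elim: j => [|j IH]; first by rewrite leqn0 => /eqP->.
rewrite leq_eqVlt => /orP[/eqP->//|]; rewrite ltnS => /IH; exact: leq_trans.
Qed.

(** A part that drops to 0 stays in the sequence, so removing a corner keeps the length and the row
    indices. *)
Definition remove_box i (la : seq nat) := set_nth 0 la i (nth 0 la i).-1.

Lemma nth_remove_box la i j :
  nth 0 (remove_box i la) j = nth 0 la j - (j == i).
Proof.
rewrite nth_set_nth /=; case: eqP => [->|_]; last by rewrite subn0.
by rewrite subn1.
Qed.

Lemma size_remove_box la i : i < size la -> size (remove_box i la) = size la.
Proof. by move=> ilt; rewrite size_set_nth; apply/maxn_idPr. Qed.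

Lemma sorted_remove_box la i : sorted geq la -> nth 0 la i.+1 < nth 0 la i ->
  sorted geq (remove_box i la).
Proof.
move=> /sorted_geqP H Hi; apply/sorted_geqP => j; rewrite !nth_remove_box.
have := H j; have [->|ji] := eqVneq j i; last lia.
by case: eqP => [|]; lia.
Qed.

Lemma corner_size la i : nth 0 la i.+1 < nth 0 la i -> i < size la.
Proof. by case: (ltnP i (size la)) => // /(nth_default 0)->. Qed.

Lemma sumn_remove_box la i : nth 0 la i.+1 < nth 0 la i ->
  sumn la = (sumn (remove_box i la)).+1.
Proof.
move=> Hi; have isz := corner_size Hi.
rewrite sumn_set_nth isz muln1.
have : nth 0 la i <= sumn la.
  by rewrite (sumn_nth (leqnn _)) (bigD1 (Ordinal isz)) //= leq_addr.
by lia.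
Qed.

(** * Cells of skew diagrams and the branching rule for tableaux *)

Lemma skew_cell_ex la mu i j : sorted geq la -> nth 0 mu i <= j < nth 0 la i ->
  exists c : skew_cell la mu, ((val c).1 = i :> nat) /\ ((val c).2 = j :> nat).
Proof.
move=> s /andP[muj jla].
have isz : i < size la.
  by case: (ltnP i (size la)) => // /(nth_default 0) e; rewrite e in jla.
have jh : j < head 0 la by rewrite -nth0 (leq_trans jla) // sorted_geq_nth.
have P : (Ordinal isz, Ordinal jh) \in skew_cells la mu by rewrite inE muj.
by exists (exist (fun c => c \in skew_cells la mu) _ P).
Qed.

Lemma skew_cellP la mu (c : skew_cell la mu) :
  nth 0 mu (val c).1 <= (val c).2 < nth 0 la (val c).1.
Proof. by have := valP c; rewrite inE. Qed.

Lemma skew_cell_inj la mu (c d : skew_cell la mu) :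
  (val c).1 = (val d).1 :> nat -> (val c).2 = (val d).2 :> nat -> c = d.
Proof.
move=> /val_inj e1 /val_inj e2; apply/val_inj.
by rewrite [val c]surjective_pairing e1 e2 -surjective_pairing.
Qed.

(** The last cell [b] of a corner row is maximal for [cell_lt], so [card_lin_ext_max] applies with
    an [h] that keeps the coordinates of each cell. *)
Lemma card_lin_ext_corner la mu (b : skew_cell la mu) (i : nat) :
  sorted geq la -> sorted geq mu -> part_le mu la ->
  (val b).1 = i :> nat -> (val b).2.+1 = nth 0 la i ->
  nth 0 la i.+1 < nth 0 la i ->
  #|[set t in lin_ext (@cell_lt la mu) #|skew_cell la mu| |
       (t b).+1 == #|skew_cell la mu| ]| =
  num_syt (remove_box i la) mu.
Proof.
move=> sla smu /part_leP le b1 b2 cor.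
have bP := skew_cellP b; rewrite b1 in bP.
have sla' := sorted_remove_box sla cor.
have le' : part_le mu (remove_box i la).
  apply/part_leP=> j; rewrite nth_remove_box; have := le j.
  by case: eqP => [->|]; lia.
rewrite (num_syt_lin_ext le').
have hP (y : skew_cell (remove_box i la) mu) : exists c : skew_cell la mu,
    ((val c).1 = (val y).1 :> nat) /\ ((val c).2 = (val y).2 :> nat).
  apply: skew_cell_ex => //; have /andP[-> ] := skew_cellP y; rewrite nth_remove_box /=; move/leq_trans; apply; exact: leq_subr.
pose h y := sval (cid (hP y)).
have h1 y : ((val (h y)).1 = (val y).1 :> nat) by have [] := svalP (cid (hP y)).
have h2 y : ((val (h y)).2 = (val y).2 :> nat) by have [] := svalP (cid (hP y)).
have hI : injective h.
  move=> y z e; apply: skew_cell_inj; by rewrite -?h1 -?h2 e.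
have hb y : h y != b.
  apply/eqP=> e; have := skew_cellP y; rewrite -h1 -h2 e b1 nth_remove_box.
  by rewrite eqxx; lia.
have hs x : x != b -> exists y, h y = x.
  move=> xb; have xP := skew_cellP x.
  have [|y [y1 y2]] := @skew_cell_ex (remove_box i la) mu (val x).1 (val x).2 sla'.
    rewrite nth_remove_box; case: eqP => [e|]; last by rewrite subn0.
    rewrite e in xP *; rewrite subn1; suff /eqP : (val x).2 != (val b).2 :> nat by move: xP b2; move: (val x).2 (val b).2 => p q; lia.
    by apply: contra xb => /eqP e2; apply/eqP/skew_cell_inj; rewrite ?e ?b1.
  by exists y; apply: skew_cell_inj; rewrite ?h1 ?h2.
have cardX : #|skew_cell la mu| = #|skew_cell (remove_box i la) mu|.+1.
  have <- : #|[set~ b]| = #|skew_cell (remove_box i la) mu|.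
    rewrite -(card_imset predT hI); congr #|pred_of_set _|.
    apply/setP=> x; rewrite !inE; apply/idP/imsetP => [/hs[y <-]|[y _ ->]]; first by exists y.
    exact: hb.
  by rewrite cardsC1 prednK //; apply/card_gt0P; exists b.
rewrite cardX -(@card_lin_ext_max _ _ (@cell_lt la mu) (@cell_lt (remove_box i la) mu) _ h b hI hb hs).
- by congr #|pred_of_set _|; apply/setP=> t; rewrite !inE.
- by move=> y z; rewrite /cell_lt -!val_eqE /= !h1 !h2.
move=> x; apply/negbTE/negP; rewrite /cell_lt -!val_eqE /= b1 => bx.
have /andP[_ ] := skew_cellP x; rewrite ltnNge => /negP; apply.
case/orP: bx => /andP[/eqP<- bx]; first by rewrite -b2.
by rewrite (leq_trans (sorted_geq_nth sla bx)) // -ltnS b2.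
Qed.

(** Tableaux are classified by the row of their largest entry, whose cell must be a corner of
    [la]. *)
Lemma num_syt_rec la mu :
  sorted geq la -> sorted geq mu -> sumn mu < sumn la ->
  num_syt la mu = \sum_(i < size la | nth 0 la i.+1 < nth 0 la i)
                     num_syt (remove_box i la) mu.
Proof.
move=> sla smu lts.
have [le|/negbTE nle] := boolP (part_le mu la); last first.
  rewrite [LHS]/num_syt nle big1 // => i _; rewrite /num_syt ifF //.
  apply/negbTE; apply: contraFN nle => /part_leP le; apply/part_leP=> j.
  by apply: leq_trans (le j) _; rewrite nth_remove_box leq_subr.
have [x0 _] : exists x0 : skew_cell la mu, true.
  case: (pickP (@predT (skew_cell la mu))) => [x _|none]; first by exists x.
  have lt' : sumn la <= sumn mu.
    set N := maxn (size la) (size mu).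
    rewrite (@sumn_nth la N) ?leq_maxl // (@sumn_nth mu N) ?leq_maxr //.
    apply: leq_sum => i _; rewrite leqNgt; apply/negP=> lti.
    by have [|c _] := @skew_cell_ex la mu i (nth 0 mu i) sla;
      [rewrite leqnn | have := none c].
  by move: lts; rewrite ltnNge lt'.
have leP := elimT (part_leP mu la) le.
set X := skew_cell la mu in x0 *.
have X0 : 0 < #|X| by apply/card_gt0P; exists x0.
rewrite (num_syt_lin_ext le) -sum1_card.
(* [x0] is only a default: a linear extension with as many labels as cells is a bijection, so some
   cell carries the last label. *)
pose top (t : {ffun X -> 'I_#|X|}) : X := odflt x0 [pick c | (t c).+1 == #|X|].
have topP t : t \in lin_ext (@cell_lt la mu) #|X| ->
    forall c, ((t c).+1 == #|X|) = (c == top t).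
  move=> /lin_extP[tI _] c; rewrite /top; case: pickP => [d /eqP td /=|none].
    apply/eqP/eqP => [tc|-> //]; apply/tI/val_inj.
    by apply/eqP; rewrite -eqSS tc td.
  have lt1 : #|X|.-1 < #|X| by rewrite prednK.
  have [f fK tK] : bijective t by apply: inj_card_bij => //; rewrite card_ord.
  by have := none (f (Ordinal lt1)); rewrite tK /= prednK // eqxx.
rewrite (partition_big (fun t => (val (top t)).1) (fun i => nth 0 la i.+1 < nth 0 la i)); last first.
  move=> t tlin; have /lin_extP[tI te] := tlin.
  have := topP _ tlin (top t); rewrite eqxx => /eqP tt.
  have := skew_cellP (top t); set b := top t in tt *; move=> /andP[bm bl].
  rewrite ltnNge; apply/negP=> ge.
  (* The next row is long enough to have a cell below the largest entry, which would need a still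
     larger one. *)
  have [|c [c1 c2]] := @skew_cell_ex la mu (val b).1.+1 (val b).2 sla.
    by rewrite (leq_trans _ bm) ?(leq_trans bl) // sorted_geq_nth.
  have /te : cell_lt b c by rewrite /cell_lt -!val_eqE /= c1 c2 eqxx ltnSn orbT.
  by rewrite tt leqNgt ltn_ord.
apply: eq_bigr => i cor; rewrite sum1_card.
(* If row [i] has no cell outside [mu], both counts are 0. *)
have [lti|gei] := ltnP (nth 0 mu i) (nth 0 la i); last first.
  rewrite /num_syt ifF; last first.
    apply/negP=> /part_leP/(_ i); rewrite nth_remove_box eqxx; lia.
  apply/eqP; rewrite -leqn0 leqNgt; apply/negP=> /card_gt0P[t].
  move=> /andP[_ /eqP e]; have := skew_cellP (top t); rewrite e; lia.
have [|b [b1 b2]] := @skew_cell_ex la mu i (nth 0 la i).-1 sla; first lia.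
have b2' : (val b).2.+1 = nth 0 la i by rewrite b2 prednK //; lia.
rewrite -(card_lin_ext_corner sla smu le b1 b2' cor).
apply: eq_card => t; rewrite [RHS]inE unfold_in /=; case: (boolP (t \in _)) => //= tlin.
rewrite topP //; apply/eqP/eqP => [e|<-]; last exact/val_inj.
apply: skew_cell_inj; first by rewrite b1 e.
have := topP _ tlin (top t); rewrite eqxx => /eqP tt.
have /lin_extP[tI te] := tlin.
have tP := skew_cellP (top t); rewrite e in tP.
apply/eqP; rewrite b2 eqn_leq; apply/andP; split; last first.
  by rewrite -ltnS prednK; [case/andP: tP | exact: leq_ltn_trans lti].
(* [b] ends row [i]; were the largest entry further left, [b] would carry a larger one. *)
rewrite leqNgt; apply/negP=> lt.
have /te : cell_lt (top t) b by rewrite /cell_lt -!val_eqE /= e b1 eqxx b2 lt.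
by rewrite tt leqNgt ltn_ord.
Qed.

(** Containment with equal sums leaves no cell, hence exactly one, empty, filling. *)
Lemma num_syt_eq_size la mu : sorted geq la -> sumn la = sumn mu ->
  num_syt la mu = part_le mu la.
Proof.
move=> sla es; rewrite /num_syt; case: ifP => // /part_leP le.
have leN N : \sum_(i < N) nth 0 mu i <= \sum_(i < N) nth 0 la i.
  by apply: leq_sum => i _; apply: le.
have no (c : skew_cell la mu) : False.
  have := skew_cellP c; set i := (val c).1 => /andP[ci1 ci2].
  set N := maxn (size la) (size mu).
  have iN : i < N by rewrite (leq_trans (ltn_ord _)) // leq_maxl.
  move: es; rewrite (@sumn_nth la N) ?leq_maxl // (@sumn_nth mu N) ?leq_maxr //.
  rewrite (bigD1 (Ordinal iN)) //= [in RHS](bigD1 (Ordinal iN)) //=.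
  move=> e; have : \sum_(j < N | j != Ordinal iN) nth 0 mu j <=
         \sum_(j < N | j != Ordinal iN) nth 0 la j.
    by apply: leq_sum => j _; apply: le.
  move=> le'; have := leq_add (leq_ltn_trans ci1 ci2) le'.
  by rewrite e addSn ltnn.
have X0 : #|skew_cell la mu| = 0.
  by apply/eqP; rewrite -leqn0 leqNgt; apply/negP=> /card_gt0P[c] _; apply: no.
have := num_syt_lin_ext (introT (part_leP mu la) le).
rewrite /num_syt (introT (part_leP mu la) le) => ->.
have -> : lin_ext (@cell_lt la mu) #|skew_cell la mu| = [set: _].
  apply/setP=> t; rewrite finset.in_setT; apply/lin_extP; split=> [c|c]; by case: (no c).
by rewrite cardsT card_ffun X0 expn0.
Qed.

Local Open Scope ring_scope.

(** * Finite differences and polynomial degree *)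

Definition nabla (g : int -> int) (x : int) : int := g x - g (x - 1).

(** On integer functions this characterises the polynomials of degree less than [k]; for [k = 0]
    only the zero function qualifies. *)
Definition deg_lt (k : nat) (g : int -> int) : Prop := iter k nabla g =1 fun=> 0.

Lemma deg_ltS k g : deg_lt k.+1 g <-> deg_lt k (nabla g).
Proof. by rewrite /deg_lt iterSr. Qed.

Lemma eq_deg_lt k g h : g =1 h -> deg_lt k g -> deg_lt k h.
Proof. by move=> /funext->. Qed.

Lemma deg_ltW k k' g : (k <= k')%N -> deg_lt k g -> deg_lt k' g.
Proof.
move=> /subnK <-; elim: (k' - k)%N => [//|j IH] H x.
by rewrite addSn iterS /nabla !(IH H) subrr.
Qed.

Lemma deg_ltD k g h : deg_lt k g -> deg_lt k h -> deg_lt k (fun x => g x + h x).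
Proof.
elim: k g h => [|k IH] g h; first by rewrite /deg_lt /= => Hg Hh x; rewrite (Hg x) (Hh x) addr0.
rewrite !deg_ltS => Hg Hh; apply: eq_deg_lt (IH _ _ Hg Hh) => x.
by rewrite /nabla; ring.
Qed.

(** Product rule: [nabla] turns [(x - a) * g x] into [(x - (a + 1)) * nabla g x + g x]. The
    induction is over all [a] because of this shift. *)
Lemma deg_ltM k a g : deg_lt k g -> deg_lt k.+1 (fun x => (x - a) * g x).
Proof.
elim: k g a => [|k IH] g a.
  by rewrite /deg_lt /= => Hg x; rewrite /nabla (Hg x) (Hg (x - 1)) !mulr0 subrr.
move=> Hg; apply/deg_ltS.
apply: (@eq_deg_lt _ (fun x => (x - (a + 1)) * nabla g x + g x)).
  by move=> x; rewrite /nabla; ring.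
by apply: deg_ltD => //; apply: IH; apply/deg_ltS.
Qed.

Lemma deg_lt_prod (s : seq int) : deg_lt (size s).+1 (fun x => \prod_(a <- s) (x - a)).
Proof.
elim: s => [|a s IH].
  by move=> x; rewrite /= /nabla !big_nil subrr.
by apply: eq_deg_lt (deg_ltM a IH) => x; rewrite big_cons.
Qed.

(** * Shift operators on functions of the coordinates *)

Section Operators.
Variable L : nat.
Implicit Types (l : {ffun 'I_L -> int}) (f w : {ffun 'I_L -> int} -> int).

Definition lower (j : nat) (k : 'I_L) l : {ffun 'I_L -> int} :=
  [ffun x => l x - (j * (x == k))%:Z].

(** The operator X^j_g; [branch] is B. *)
Definition shift_op (j : nat) (g : int -> int) f : {ffun 'I_L -> int} -> int :=
  fun l => \sum_k g (l k) * f (lower j k l).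

Definition branch : ({ffun 'I_L -> int} -> int) -> {ffun 'I_L -> int} -> int :=
  shift_op 1 (fun=> 1).

Lemma branchE f l : branch f l = \sum_k f (lower 1 k l).
Proof. by apply: eq_bigr => k _; rewrite mul1r. Qed.

Lemma branchD f w : branch (fun l => f l + w l) = fun l => branch f l + branch w l.
Proof.
apply/funext=> l; rewrite !branchE -big_split /=; exact: eq_bigr.
Qed.

Lemma iter_branchD r f w :
  iter r branch (fun l => f l + w l) =
  fun l => iter r branch f l + iter r branch w l.
Proof. by elim: r => [//|r IH]; rewrite iterS IH branchD. Qed.

(** Terms at two distinct coordinates commute. At a single coordinate the two orders evaluate [g] at
    [l k] and at [l k - 1], and the difference is [nabla g] with the combined shift [j.+1]. *)
Lemma shift_op_branch j g f l :
  shift_op j g (branch f) l =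
  branch (shift_op j g f) l + shift_op j.+1 (nabla g) f l.
Proof.
have e1 k k' : lower 1 k' (lower j k l) = lower j k (lower 1 k' l).
  by apply/ffunP=> x; rewrite !ffunE addrAC.
rewrite branchE /shift_op exchange_big -big_split /=; apply: eq_bigr => k _.
rewrite branchE mulr_sumr (bigD1 k) //= [in RHS](bigD1 k) //= addrAC; congr (_ + _).
  have -> : lower j.+1 k l = lower j k (lower 1 k l).
    by apply/ffunP=> x; rewrite !ffunE; case: (x == k); lia.
  by rewrite e1 [in RHS]ffunE eqxx muln1 /nabla; ring.
apply: eq_bigr => k' /negbTE kk'; rewrite -e1 ffunE.
by rewrite eq_sym kk' muln0 subr0.
Qed.

Definition alternating f := forall (i j : 'I_L) l, i != j ->
  f [ffun k => l (tperm i j k)] = - f l.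

(** The bound 1 - L is the last coordinate of the empty partition; the condition kills removals that
    would make the last of the L parts negative. *)
Definition low_vanishing f := forall l (i : 'I_L), l i < 1 - L%:Z -> f l = 0.

Definition good f := alternating f /\ low_vanishing f.

(** The operator treats all coordinates alike and can only decrease them, so both conditions
    survive. *)
Lemma shift_op_good j g f : good f -> good (shift_op j g f).
Proof.
move=> [fa fl]; split.
  move=> a b l ab; rewrite /shift_op (reindex_inj (@perm_inj _ (tperm a b))) /=.
  rewrite -sumrN; apply: eq_bigr => k _; rewrite ffunE tpermK -mulrN -(fa a b) //.
  congr (_ * f _); apply/ffunP=> x; rewrite !ffunE.
  by rewrite -(inj_eq (@perm_inj _ (tperm a b)) x) tpermK.
move=> l i li; apply: big1 => k _; rewrite (fl _ i) ?mulr0 // ffunE.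
by apply: le_lt_trans li; rewrite gerBl.
Qed.

Lemma iter_branch_good r f : good f -> good (iter r branch f).
Proof. by elim: r => [//|r IH] /IH; apply: shift_op_good. Qed.

Lemma goodD f w : good f -> good w -> good (fun l => f l + w l).
Proof.
move=> [fa fl] [wa wl]; split=> [a b l ab|l i li]; first by rewrite fa // wa // opprD.
by rewrite (fl l i) // (wl l i) // addr0.
Qed.

(* Each commutation with [branch] lowers the degree of [g], so that at most [m]
   of the [m + q] factors [branch] are lost in moving them to the left. *)
Lemma shift_op_iter_branch m g j q f : good f -> deg_lt m.+1 g ->
  exists2 w, good w & shift_op j g (iter (m + q) branch f) = iter q branch w.
Proof.
move=> fg; elim: m g j q => [|m IHm] g j; elim=> [|q IHq] gd.
- by exists (shift_op j g f) => //; apply: shift_op_good.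
- have [w wg e] := IHq gd; exists w => //; apply/funext=> l.
  rewrite addnS iterS shift_op_branch e [X in _ + X]big1 ?addr0 // => k _.
  by have /= -> := gd (l k); rewrite mul0r.
- rewrite addn0; exists (shift_op j g (iter m.+1 branch f)) => //.
  exact/shift_op_good/iter_branch_good.
have [w wg e] := IHq gd.
(* The commutator term has one degree less; the same number of factors is now split as
   [m + q.+1]. *)
have [w' wg' e'] := IHm (nabla g) j.+1 q.+1 (proj1 (deg_ltS _ _) gd).
exists (fun l => w l + w' l); first exact: goodD.
apply/funext=> l; rewrite addnS iterS shift_op_branch e iter_branchD -e'.
by rewrite addnS addSn.
Qed.

(* The antisymmetrised indicator function of the coordinates of the empty
   partition. *)
Definition vacuum l : int := \det (\matrix_(i < L, j < L) ((l i == - j%:Z)%:R : int)).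

(** Swapping two coordinates swaps two rows of the matrix; a coordinate below 1 - L differs from
    every [- j] and gives a zero row. *)
Lemma vacuum_good : good vacuum.
Proof.
split.
  move=> a b l ab; rewrite /vacuum.
  set M := (X in - \det X).
  have -> : (\matrix_(i < L, j < L) (([ffun k => l (tperm a b k)] i == - j%:Z)%:R : int))
    = row_perm (tperm a b) M by apply/matrixP=> i j; rewrite !mxE ffunE.
  by rewrite row_permE det_mulmx det_perm odd_tperm ab /= expr1 mulN1r.
move=> l i li; rewrite /vacuum (expand_det_row _ i) big1 // => j _.
rewrite mxE (_ : (_ == _) = false) ?mul0r //; apply/negbTE/eqP => e.
by move: li; rewrite e; have := ltn_ord j; lia.
Qed.

Definition coords (la : seq nat) : {ffun 'I_L -> int} :=
  [ffun i : 'I_L => (nth 0%N la i)%:Z - i%:Z].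

Lemma vacuum_nil la : nth 0%N la =1 (fun=> 0%N) -> vacuum (coords la) = 1.
Proof.
move=> e; rewrite /vacuum (_ : \matrix_(i, j) _ = 1%:M) ?det1 //.
apply/matrixP=> i j; rewrite !mxE ffunE e sub0r eqr_opp.
by rewrite -val_eqE.
Qed.

Lemma coords_remove_box la (i : 'I_L) : (nth 0 la i.+1 < nth 0 la i)%N ->
  lower 1 i (coords la) = coords (remove_box i la).
Proof.
move=> cor; apply/ffunP=> x; rewrite !ffunE nth_remove_box -val_eqE /= mul1n.
by case: eqP => [->|]; lia.
Qed.

(* Removing a box that is not a corner makes two coordinates equal, or makes the
   last one fall below the least admissible value. *)
Lemma good_noncorner f la (i : 'I_L) : sorted geq la -> (size la <= L)%N -> good f ->
  ~~ (nth 0 la i.+1 < nth 0 la i)%N -> f (lower 1 i (coords la)) = 0.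
Proof.
move=> /sorted_geqP s szL [fa fl]; rewrite -leqNgt => le.
have {s le}eqi : nth 0%N la i.+1 = nth 0%N la i by apply/eqP; rewrite eqn_leq s le.
have [ltiL|] := ltnP i.+1 L; last first.
  move=> leL; apply: (fl _ i); rewrite !ffunE eqxx -eqi nth_default ?(leq_trans szL) //.
  by lia.
pose j := Ordinal ltiL; have ij : i != j by rewrite -val_eqE /= neq_ltn ltnSn.
have := fa i j (lower 1 i (coords la)) ij.
have -> : [ffun k => lower 1 i (coords la) (tperm i j k)] = lower 1 i (coords la).
  apply/ffunP=> k; rewrite ffunE; case: tpermP => // ->; rewrite !ffunE eqxx.
    by rewrite eq_sym (negbTE ij) /= eqi; lia.
  by rewrite eq_sym (negbTE ij) /= eqi; lia.
by lia.
Qed.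

(** Rows that are not corners contribute 0 by [good_noncorner], so [branch] acts as the branching
    rule on partitions. *)
Lemma branch_corners f la : sorted geq la -> (size la <= L)%N -> good f ->
  branch f (coords la) =
  \sum_(i < size la | (nth 0 la i.+1 < nth 0 la i)%N) f (coords (remove_box i la)).
Proof.
move=> s szL fg.
rewrite (big_ord_widen_cond L (fun i => nth 0 la i.+1 < nth 0 la i)%N
          (fun i => f (coords (remove_box i la)))) //.
rewrite branchE big_mkcond [RHS]big_mkcond /=; apply: eq_bigr => i _.
case: ifP => [|/negbT H].
  by move=> /andP[c _]; rewrite coords_remove_box.
apply: good_noncorner => //; apply: contra H => c; rewrite c; exact: corner_size c.
Qed.

Lemma last_corner la : (0 < sumn la)%N -> exists i : 'I_(size la), (nth 0 la i.+1 < nth 0 la i)%N.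
Proof.
elim: la => //= x la IH; case: (posnP (sumn la)) => [s0|/IH[i Hi]]; last first.
  by exists (lift ord0 i).
rewrite s0 addn0 => x0; exists ord0 => /=.
by case: la s0 {IH} => //= y la; case: y.
Qed.

(** By the branching rule the value counts the standard tableaux of shape [la]. Positivity lets
    [sum_coords_eq] cancel it. *)
Lemma iter_branch_vacuum_gt0 r la : sorted geq la -> (size la <= L)%N -> sumn la = r ->
  0 < iter r branch vacuum (coords la).
Proof.
elim: r la => [|r IH] la s szL sz.
  rewrite /= vacuum_nil // => i; have := sz; rewrite (@sumn_nth la (maxn i.+1 (size la))) ?leq_maxr //.
  have iN : (i < maxn i.+1 (size la))%N by rewrite leq_max ltnSn.
  by rewrite (bigD1 (Ordinal iN)) //=; lia.
have IH' (i : 'I_(size la)) : (nth 0 la i.+1 < nth 0 la i)%N ->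
    0 < iter r branch vacuum (coords (remove_box i la)).
  move=> c; apply: IH; first exact: sorted_remove_box.
    by rewrite size_remove_box.
  by have := sumn_remove_box c; rewrite sz => -[].
rewrite iterS branch_corners //; last exact: iter_branch_good vacuum_good.
have [|i c] := @last_corner la; first by rewrite sz.
rewrite (bigD1 i) //= ltr_pwDl ?IH' // sumr_ge0 // => k /andP[ck _].
exact/ltW/IH'.
Qed.

(* Partitions with trailing zero parts are allowed here, because [remove_box]
   creates them. *)
Lemma iter_branch_num_syt (ps : seq (seq nat)) m r la w :
  uniq ps -> (forall tau, (tau \in ps) = partition_of m tau) ->
  good w -> sorted geq la -> (size la <= L)%N -> sumn la = (r + m)%N ->
  iter r branch w (coords la) =
  \sum_(tau <- ps) w (coords tau) * (num_syt la tau)%:Z.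
Proof.
move=> ups psP wg; elim: r la => [|r IH] la s szL sz.
  (* With no [branch] left, the only partition of [m] that contributes is [la] stripped of its zero
     parts. *)
  set la' := [seq x <- la | x != 0%N].
  have nth' i : nth 0%N la' i = nth 0%N la i.
    rewrite /la'; elim: la s i {szL sz la'} => //= x la IHla.
    rewrite (path_sortedE (rev_trans leq_trans)) => /andP[/allP ax s].
    case: eqP => [x0|_] i; last by case: i => //= i; exact: IHla.
    have z j : nth 0%N la j = 0%N.
      have [/(mem_nth 0%N)/ax|/(nth_default 0%N)-> //] := ltnP j (size la).
      by rewrite x0 /=; case: (nth _ _ _).
    by rewrite IHla // z; case: i => [|i] //=; rewrite z.
  have sum' : sumn la' = m.
    rewrite -[RHS]add0n -sz (@sumn_nth la' (size la)) ?size_filter ?count_size //.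
    by rewrite (@sumn_nth la (size la)) //; apply: eq_bigr => i _.
  have part' : partition_of m la'.
    apply/and3P; split; last exact/eqP.
      by apply/sorted_geqP=> i; rewrite !nth'; apply/sorted_geqP.
    by rewrite mem_filter.
  have le' : part_le la' la by apply/part_leP=> i; rewrite nth'.
  rewrite /= (bigD1_seq la') ?psP //= num_syt_eq_size ?sum' // le' mulr1.
  rewrite big1_seq ?addr0; first by congr w; apply/ffunP=> i; rewrite !ffunE nth'.
  move=> tau /andP[ne]; rewrite psP => pt.
  have [_ _ /eqP st] := and3P pt.
  rewrite num_syt_eq_size // ?st //; case: part_leP => [le|]; last by rewrite mulr0.
  case/eqP: ne; apply: partition_of_inj pt part' _.
  by apply/part_leP=> i; rewrite nth'.
rewrite iterS branch_corners //; last exact: iter_branch_good.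
transitivity (\sum_(i < size la | (nth 0 la i.+1 < nth 0 la i)%N)
   \sum_(tau <- ps) w (coords tau) * (num_syt (remove_box i la) tau)%:Z).
  apply: eq_bigr => i c; apply: IH; first exact: sorted_remove_box.
    by rewrite size_remove_box.
  by have := sumn_remove_box c; rewrite sz addSn => -[].
rewrite exchange_big /= big_seq [RHS]big_seq; apply: eq_bigr => tau.
rewrite psP => /and3P[st _ /eqP sumt]; rewrite -mulr_sumr; congr (_ * _).
by rewrite (num_syt_rec s st) ?sumt ?sz; [rewrite (big_morph Posz PoszD (erefl _)) | lia].
Qed.

End Operators.

(** * Coordinate sums determined by the minors *)

Fixpoint seqs_upto (m k : nat) : seq (seq nat) :=
  if k is k'.+1 then
    [::] :: [seq x :: s | s <- seqs_upto m k', x <- iota 0 m.+1]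
  else [:: [::]].

Lemma mem_seqs_upto m k s :
  (size s <= k)%N -> all (geq m) s -> s \in seqs_upto m k.
Proof.
elim: k s => [|k IH] [|x s] // sk /andP[xm sm].
rewrite inE; apply/orP; right; apply/allpairsP; exists (s, x).
by rewrite IH // mem_iota.
Qed.

Lemma partitions_enum m :
  exists ps : seq (seq nat), uniq ps /\ forall tau, (tau \in ps) = partition_of m tau.
Proof.
(* A partition of [m] has at most [m] parts, each at most [m]. *)
exists (undup [seq tau <- seqs_upto m m | partition_of m tau]); split; first exact: undup_uniq.
move=> tau; rewrite mem_undup mem_filter; case: (boolP (partition_of m tau)) => //=.
move=> /and3P[_ t0 /eqP st]; apply: mem_seqs_upto.
  rewrite -st; elim: tau t0 {st} => //= x s IH; rewrite inE negb_or => /andP[x0 /IH].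
  by lia.
rewrite -st; elim: tau {st t0} => //= x s IH; rewrite leq_addr /=.
by apply: sub_all IH => y /= H; rewrite (leq_trans H) // leq_addl.
Qed.

(** Both [iter n branch vacuum] and its product with the sum of the [g (l i)] have the form
    [iter (n - m) branch w] with [w] good, so each takes equal values at the two partitions. The
    first value is nonzero and cancels. *)
Lemma sum_coords_eq m n la nu (g : int -> int) : (m <= n)%N ->
  partition_of n la -> partition_of n nu ->
  (forall tau, partition_of m tau -> num_syt la tau = num_syt nu tau) ->
  deg_lt m.+1 g ->
  forall L, (size la <= L)%N -> (size nu <= L)%N ->
  \sum_i g (coords L la i) = \sum_i g (coords L nu i).
Proof.
move=> mn /and3P[sla _ /eqP nla] /and3P[snu _ /eqP nnu] H gd L laL nuL.
have [ps [ups psP]] := partitions_enum m.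
have eqw w : good w -> iter (n - m) (@branch L) w (coords L la) =
                       iter (n - m) (@branch L) w (coords L nu).
  move=> wg; rewrite !(iter_branch_num_syt ups psP) ?subnK //.
  by rewrite big_seq [RHS]big_seq; apply: eq_bigr => tau; rewrite psP => /H->.
have eqv : iter n (@branch L) (@vacuum L) (coords L la) =
           iter n (@branch L) (@vacuum L) (coords L nu).
  by rewrite -[in iter n](subnK mn) iterD eqw //; exact/iter_branch_good/vacuum_good.
have [w wg /funeqP e] := shift_op_iter_branch 0 (n - m) (@vacuum_good L) gd.
(* With shift 0 the operator is multiplication by the sum of the [g (l i)]. *)
have e' (l : {ffun 'I_L -> int}) : (\sum_i g (l i)) * iter n (@branch L) (@vacuum L) l = iter (n - m) (@branch L) w l.
  have := e l; rewrite subnKC // => <-; rewrite /shift_op mulr_suml; apply: eq_bigr => k _.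
  by congr (_ * _); congr (iter _ _ _ _); apply/ffunP=> x; rewrite ffunE mul0n subr0.
have v0 : iter n (@branch L) (@vacuum L) (coords L nu) != 0.
  by rewrite gt_eqF // iter_branch_vacuum_gt0.
by apply: (mulIf v0); rewrite e' -eqw // -e' eqv.
Qed.

(** * Run ends of finite sets of integers and of partitions *)

(** The value is 1 at the upper end of a run of consecutive elements, -1 just below a run, and 0
    elsewhere. *)
Definition jump (A : seq int) (x : int) : int :=
  (x \in A)%:R - (x + 1 \in A)%:R.

(** Summation by parts gives the sum of [jump A x * P x] over all [x], of which only the term at
    [x0] survives. *)
Lemma sum_nabla_jump (A : seq int) (P : int -> int) (x0 : int) : uniq A ->
  (forall x, x != x0 -> jump A x != 0 -> P x = 0) ->
  \sum_(a <- A) nabla P a = jump A x0 * P x0.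
Proof.
(* [u] contains every point where a summand can be nonzero, and also [x0], so that its term can be
   split off. *)
move=> uA H; set u := undup (x0 :: A ++ [seq a - 1 | a <- A]).
have uu : uniq u by apply: undup_uniq.
have extend (B : seq int) : uniq B -> {subset B <= u} ->
    \sum_(a <- B) P a = \sum_(x <- u) (x \in B)%:R * P x.
  move=> uB sB; rewrite [RHS](eq_bigr (fun x => if x \in B then P x else 0)); last first.
    by move=> x _; case: (x \in B); rewrite ?mul1r ?mul0r.
  rewrite -big_mkcond -big_filter; apply: perm_big; apply: uniq_perm => //.
    exact: filter_uniq.
  by move=> x; rewrite mem_filter /=; case: (boolP (x \in B)) => //= /sB->.
have inj1 : injective (fun a : int => a - 1) by move=> a b; lia.
rewrite /nabla big_split /= sumrN -(big_map (fun a : int => a - 1) predT P).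
rewrite !extend ?map_inj_uniq //; first last.
- by move=> x xA; rewrite mem_undup inE mem_cat xA orbT.
- by move=> x xA; rewrite mem_undup inE mem_cat xA !orbT.
rewrite -sumrB (bigD1_seq x0) ?mem_undup ?mem_head //= big1 ?addr0.
  rewrite -mulrBl /jump -[in X in _ = (_ - X) * _](mem_map inj1).
  by rewrite addrK.
move=> x xx0; rewrite -mulrBl.
have -> : (x \in [seq a - 1 | a <- A]) = (x + 1 \in A).
  by rewrite -[RHS](mem_map inj1) addrK.
have [->|j] := eqVneq ((x \in A)%:R - (x + 1 \in A)%:R : int) 0; first by rewrite mul0r.
by rewrite (H x xx0 j) mulr0.
Qed.

(** Equal jumps make the difference of the two indicator functions invariant under translation by 1,
    and it is 0 above both finite sets. *)
Lemma jump_inj (A B : seq int) : jump A =1 jump B -> A =i B.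
Proof.
move=> H x.
pose u y : int := (y \in A)%:R - (y \in B)%:R.
have step y : u y = u (y + 1).
  have := H y; rewrite /jump /u.
  by case: (y \in A); case: (y \in B); case: (y + 1 \in A); case: (y + 1 \in B).
have steps k : u x = u (x + k%:Z).
  elim: k => [|k IH]; first by rewrite addr0.
  by rewrite IH step; congr u; lia.
have [k kP] : exists k : nat, forall y, y \in A ++ B -> y < x + k%:Z.
  elim: (A ++ B) => [|a s [k kP]]; first by exists 0%N.
  exists (maxn k (`|a| + `|x|).+1) => y; rewrite inE => /predU1P[->|/kP]; lia.
have : u x = 0.
  rewrite (steps k) /u.
  have := kP (x + k%:Z); rewrite mem_cat ltxx.
  by case: (_ \in A); case: (_ \in B) => //= /(_ isT).
by rewrite /u; case: (_ \in A); case: (_ \in B).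
Qed.

(* The coordinates [la_i - i]; [i] ranges over [iota 0 L] so that the list is
   strictly decreasing with trailing zero parts allowed. *)
Definition beta (L : nat) (la : seq nat) : seq int :=
  [seq (nth 0%N la i)%:Z - i%:Z | i <- iota 0 L].

Lemma betaP L la (x : int) :
  reflect (exists2 i, (i < L)%N & x = (nth 0%N la i)%:Z - i%:Z) (x \in beta L la).
Proof.
by apply: (iffP mapP) => -[i ii ->]; exists i => //; move: ii; rewrite mem_iota.
Qed.

Lemma beta_lt la i j : sorted geq la -> (i < j)%N ->
  (nth 0%N la j)%:Z - j%:Z < (nth 0%N la i)%:Z - i%:Z.
Proof. by move=> s ij; have := sorted_geq_nth s (ltnW ij); lia. Qed.

Lemma beta_uniq L la : sorted geq la -> uniq (beta L la).
Proof.
move=> s; rewrite map_inj_uniq ?iota_uniq // => i j e.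
by case: (ltngtP i j) => // /(beta_lt s); rewrite e ltxx.
Qed.

(** Strictly decreasing lists with the same entries agree position by position: an entry at position
    [i] of one list cannot occur earlier in the other, where the entries already agree. *)
Lemma beta_mem_inj L la nu : sorted geq la -> sorted geq nu ->
  beta L la =i beta L nu -> forall i, (i < L)%N -> nth 0%N la i = nth 0%N nu i.
Proof.
move=> sla snu e.
have le la' nu' i : sorted geq la' -> sorted geq nu' ->
    beta L la' =i beta L nu' -> (i < L)%N ->
    (forall j, (j < i)%N -> nth 0%N la' j = nth 0%N nu' j) ->
    (nth 0%N la' i <= nth 0%N nu' i)%N.
  move=> sla' snu' e' iL IH.
  have /betaP[j jL ej] : (nth 0%N la' i)%:Z - i%:Z \in beta L nu'.
    by rewrite -e'; apply/betaP; exists i.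
  have [ji|ij] := ltnP j i; first by have := beta_lt sla' ji; rewrite (IH j ji) -ej ltxx.
  by have := sorted_geq_nth snu' ij; lia.
elim/ltn_ind => i IH iL; apply/eqP; rewrite eqn_leq.
rewrite !le // => j ji; first by rewrite IH // (ltn_trans ji).
by rewrite IH // (ltn_trans ji).
Qed.

(** The last rows of the blocks of equal nonzero parts. *)
Definition descents (L : nat) (la : seq nat) : seq nat :=
  [seq i <- iota 0 L | nth 0%N la i != nth 0%N la i.+1].

(** The parts at c descents are distinct and positive, so they sum to at least 1 + ... + c. The
    bound by the first part carries the induction: a new descent forces the new first part to be at
    least c + 1. *)
Lemma size_descents L la : sorted geq la ->
  (size (descents L la) <= head 0 la)%N /\
  (size (descents L la) * size (descents L la) <= 2 * sumn la)%N.
Proof.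
rewrite size_filter; elim: la L => [|x la IH] [|L] //= s.
- by rewrite (eq_count (a2 := pred0)) ?count_pred0 // => i /=; rewrite nth_nil.
- have sla : sorted geq la := path_sorted s.
  have hx : (head 0 la <= x)%N.
    by case: (la) s => //= y la' /andP[].
  have := IH L sla; rewrite -nth0 (iotaDl 1 0 L) count_map /=.
  set c := count _ _ => - [c1 c2]; rewrite nth0 in c1 *.
  by case: eqP => [e|/eqP ne]; nia.
Qed.

(** A list containing all jumps of [beta L la]: a descent [i] ends a run, with its jump one below,
    and row [i.+1] starts the next run from above. Rows [L.-1] and 0 account for the two extreme
    ends. *)
Definition jump_points (L : nat) (la : seq nat) : seq int :=
  [seq (nth 0%N la i)%:Z - i%:Z - 1 | i <- L.-1 :: descents L la] ++
  [seq (nth 0%N la i)%:Z - i%:Z | i <- 0%N :: map S (descents L la)].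

Lemma size_jump_points L la :
  size (jump_points L la) = (2 * (size (descents L la)).+1)%N.
Proof. by rewrite size_cat !size_map /= size_map mul2n addnn. Qed.

Lemma jump_pointsP L la x : sorted geq la ->
  jump (beta L la) x != 0 -> x \in jump_points L la.
Proof.
move=> s; rewrite /jump mem_cat; have [/betaP[i iL ->]|xA] := boolP (x \in _).
  have [/betaP//|xA _] := boolP (_ + 1 \in _).
  apply/orP; right; apply/mapP; exists i => //; case: i iL xA => [|i] iL xA; first by rewrite inE.
  rewrite inE mem_map; last exact: succn_inj.
  rewrite mem_filter mem_iota /= (ltnW iL) andbT; apply: contra xA => /eqP e.
  by apply/betaP; exists i; [exact: ltnW | rewrite e; lia].
have [/betaP[i iL e] _|//] := boolP (x + 1 \in _).
have -> : x = (nth 0%N la i)%:Z - i%:Z - 1 by rewrite -e addrK.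
apply/orP; left; apply/mapP; exists i => //; rewrite inE mem_filter mem_iota iL /= andbT.
have [->//|iL'] := eqVneq i L.-1; apply: contra xA => /eqP e'.
apply/betaP; exists i.+1; last by rewrite -e'; lia.
by lia.
Qed.

(** * Reconstruction from minors of size of order sqrt n *)

(** [d] bounds the descents of either partition. The two lists of jump points have at most 4d + 4
    entries, so a product over them has degree at most m + 1 and its [nabla] degree at most m. *)
Lemma reconstructible_of_large n m d : (m <= n)%N ->
  (forall c, (c * c <= 2 * n)%N -> (c <= d)%N) -> (4 * d + 3 <= m)%N ->
  mset_reconstructible n (n - m).
Proof.
move=> mn hd dm la nu pla pnu H.
have [[sla z0 /eqP nla] [snu z0' /eqP nnu]] := (and3P pla, and3P pnu).
have Hnum tau : partition_of m tau -> num_syt la tau = num_syt nu tau.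
  move=> pt; have := H tau; rewrite /minors_mset /is_minor nla nnu subKn // pt /=.
  by case: ifP => [l1|l1]; case: ifP => [l2|l2] //;
    rewrite /num_syt ?l1 ?l2.
set L := maxn (size la) (size nu).
have sumE g la' : \sum_(i < L) g (coords L la' i) = \sum_(a <- beta L la') g a.
  rewrite big_map; pose h i := g ((nth 0%N la' i)%:Z - i%:Z).
  rewrite (eq_bigr (fun i : 'I_L => h i)) => [|i _]; last by rewrite ffunE.
  by rewrite -(big_mkord predT h) /index_iota subn0.
have dsc la' : sorted geq la' -> sumn la' = n -> (size (descents L la') <= d)%N.
  by move=> s e; apply: hd; have [_] := size_descents L s; rewrite e.
(* [P] vanishes at all jumps of both partitions except possibly [x0], so the sums of [nabla P]
   isolate the jump there. *)
have key x0 : jump (beta L la) x0 = jump (beta L nu) x0.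
  pose s := [seq x <- jump_points L la ++ jump_points L nu | x != x0].
  pose P x : int := \prod_(a <- s) (x - a).
  have P0 : P x0 != 0.
    rewrite /P prodf_seq_neq0; apply/allP => a; rewrite mem_filter => /andP[ax _].
    by rewrite subr_eq0 eq_sym ax.
  have Pz x : x != x0 -> x \in jump_points L la ++ jump_points L nu -> P x = 0.
    move=> xx0 xs; apply/eqP; rewrite /P prodf_seq_eq0; apply/hasP; exists x.
      by rewrite mem_filter xx0.
    by rewrite /= subrr.
  have szs : (size s <= m.+1)%N.
    rewrite size_filter (leq_trans (count_size _ _)) // size_cat !size_jump_points.
    by have := dsc la sla nla; have := dsc nu snu nnu; lia.
  have dP : deg_lt m.+1 (nabla P).
    by apply: deg_ltW szs _; apply/deg_ltS; exact: deg_lt_prod.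
  apply: (mulIf P0).
  rewrite -!sum_nabla_jump ?beta_uniq //; first last.
  - by move=> x xx0 /(jump_pointsP sla) xs; apply: Pz => //; rewrite mem_cat xs.
  - by move=> x xx0 /(jump_pointsP snu) xs; apply: Pz => //; rewrite mem_cat xs orbT.
  rewrite -!sumE; apply: (sum_coords_eq mn pla pnu Hnum dP).
    exact: leq_maxl.
  exact: leq_maxr.
have e := beta_mem_inj sla snu (jump_inj key).
apply: partition_of_inj pla pnu _; apply/part_leP => i.
have [iL|Li] := ltnP i L; first by rewrite e.
by rewrite nth_default // (leq_trans _ Li) // leq_maxl.
Qed.

(** Take minors of size 4d + 3; for smaller n the bound is immediate. *)
Lemma G_lower_bound (n d : nat) :
  (forall c, c * c <= 2 * n -> c <= d)%N -> (n <= G n + (4 * d + 3))%N.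
Proof.
move=> hd; have [le|lt] := leqP (4 * d + 3) n; last lia.
have [_ _ GM] := GP n.
by have := GM _ (leq_subr _ n) (reconstructible_of_large le hd (leqnn _)); lia.
Qed.

(** * Asymptotic estimates *)

Section Asymptotics.
Variable R : realType.
Implicit Types n : nat.

Lemma subn_G_le_sqrt n : (0 < n)%N ->
  n%:R - (G n)%:R <= 11 * Num.sqrt (n%:R : R).
Proof.
move=> n0; set s := Num.sqrt _.
have s2 : s ^+ 2 = n%:R by rewrite sqr_sqrtr.
have s1 : 1 <= s by rewrite -[leLHS]sqrtr1 ler_wsqrtr // ler1n.
have dex : exists c, (c * c <= 2 * n)%N by exists 0%N.
have dbd c : (c * c <= 2 * n)%N -> (c <= 2 * n)%N by nia.
(* [d] is the integer part of the square root of 2n. As [d <= 2 * s] and [1 <= s], the error 4d + 3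
   is at most 8s + 3s, whence the constant 11. *)
have [d hd dmax] := ex_maxnP dex dbd.
have := G_lower_bound dmax; rewrite -(ler_nat R) 2!natrD natrM.
have : (d%:R : R) <= 2 * s.
  rewrite -ler_sqr ?nnegrE ?ler0n //; last by lra.
  rewrite exprMn s2 -!natrX -natrM ler_nat; nia.
by lra.
Qed.

(** Apply ln x < x at the square root of n, whose logarithm is half that of n. *)
Lemma ln_le_sqrt n : (0 < n)%N -> ln (n%:R : R) <= 2 * Num.sqrt (n%:R : R).
Proof.
move=> n0; have s0 : 0 < Num.sqrt (n%:R : R) by rewrite sqrtr_gt0 ltr0n.
have -> : ln (n%:R : R) = 2 * ln (Num.sqrt (n%:R : R)).
  by rewrite -{1}(@sqr_sqrtr _ (n%:R : R)) // lnXn // mulr_natl.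
by rewrite ler_pM2l // ltW // ln_sublinear.
Qed.

End Asymptotics.

Local Open Scope classical_set_scope.
Local Open Scope ring_scope.

Theorem theorem5p1 (R : realType) :
  ((fun n : nat => (G n)%:R / n%:R : R) @ \oo --> (1 : R)) /\
  ((fun n : nat => n%:R - (G n)%:R : R) =O_\oo
     (fun n : nat => n%:R / ln (n%:R : R) : R)).
Proof.
split.
  (* The ratio is squeezed between 1 - 11 / sqrt n and 1. *)
  have cvg0 : (fun n : nat => 1 - 11 * Num.sqrt (n%:R^-1 : R)) @ \oo --> (1 : R).
    have e : 1 - 11 * Num.sqrt 0 = 1 :> R by rewrite sqrtr0 mulr0 subr0.
    rewrite -[X in _ --> X]e.
    apply: cvgB; first exact: cvg_cst.
    apply: cvgMr; apply: continuous_cvg; first exact: sqrt_continuous.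
    (* An index shift turns 1/n into the harmonic sequence 1/(n + 1). *)
    by rewrite -(cvg_shiftS _); exact: cvg_harmonic.
  apply: squeeze_cvgr cvg0 (cvg_cst (1 : R)); near=> n.
  have n0 : (0 < n)%N by near: n; exact: nbhs_infty_gt.
  have nR : 0 < n%:R :> R by rewrite ltr0n.
  have [Gn _ _] := GP n.
  apply/andP; split; last by rewrite ler_pdivrMr // mul1r ler_nat.
  have := subn_G_le_sqrt R n0.
  rewrite ler_pdivlMr // mulrBl mul1r -mulrA.
  have -> : Num.sqrt (n%:R^-1) * n%:R = Num.sqrt (n%:R : R).
    rewrite sqrtrV ?ler0n // -[X in _ * X]sqr_sqrtr ?ler0n // expr2 mulKf //.
    by rewrite gt_eqF // sqrtr_gt0.
  by lra.
(* The constant is 11 * 2: the error is at most 11 sqrt n and ln n at most 2 sqrt n, so their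
   product is at most 22 n. *)
apply/eqO_exP; exists 22 => //; near=> n.
have n1 : (1 < n)%N by near: n; exact: nbhs_infty_gt.
have n0 : (0 < n)%N := ltnW n1.
have [Gn _ _] := GP n.
have ln0 : 0 < ln (n%:R : R) by rewrite ln_gt0 // ltr1n.
rewrite ger0_norm ?subr_ge0 ?ler_nat // ger0_norm ?divr_ge0 ?ler0n ?(ltW ln0) //.
rewrite mulrA ler_pdivlMr //.
have := subn_G_le_sqrt R n0; have := ln_le_sqrt R n0.
have : Num.sqrt (n%:R : R) ^+ 2 = n%:R by rewrite sqr_sqrtr.
have : 0 <= n%:R - (G n)%:R :> R by rewrite subr_ge0 ler_nat.
set s := Num.sqrt _; set u := _ - _ => u0 s2 ls us.
apply: (le_trans (ler_pM u0 (ltW ln0) us ls)).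
by rewrite -s2 expr2 mulrACA -natrM.
Unshelve. all: by end_near.
Qed.
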